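(* For every (real or complex) Banach space $X$ and every $\delta\in(0,2)$, one has $\Phi_X(\delta)\leq\sqrt{2\delta}$ and so, $\Phi_X^S(\delta)\leq\sqrt{2\delta}$.
   Context: For a (real or complex) Banach space $X\neq\{0\}$, $B_X$ and $S_X$ denote its closed unit ball and unit sphere, $X^*$ its topological dual, and $\Pi(X):=\{(x,x^* )\in X\times X^* : \|x\|=\|x^*\|=x^*(x)=1\}$. The Bishop-Phelps-Bollobás modulus $\Phi_X:(0,2)\to[0,\infty)$ is defined as follows: $\Phi_X(\delta)$ is the infimum of those $\varepsilon>0$ such that for every $(x,x^* )\in B_X\times B_{X^*}$ with $\operatorname{Re} x^*(x)>1-\delta$ there is $(y,y^* )\in\Pi(X)$ with $\|x-y\|<\varepsilon$ and $\|x^*-y^*\|<\varepsilon$. The spherical Bishop-Phelps-Bollobás modulus $\Phi_X^S:(0,2)\to[0,\infty)$ is defined in the same way with $B_X\times B_{X^*}$ replaced by $S_X\times S_{X^*}$. Banach spaces are assumed non-zero. *)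

(* Defs.v *)
From HB Require Import structures.
From mathcomp Require Import all_boot all_order all_algebra.
From mathcomp Require Import all_classical all_reals all_analysis.
From mathcomp Require Import complex.

Set Implicit Arguments.
Unset Strict Implicit.
Unset Printing Implicit Defensive.

Import Order.TTheory GRing.Theory Num.Theory.
Import numFieldNormedType.Exports.

Local Open Scope classical_set_scope.
Local Open Scope ring_scope.

(* Real and complex normed spaces are treated together: the scalar field K
   is R with re := idfun, or R[i] with re := @complex.Re R. The library norm
   of a normed module over K takes its values in K, so that the usual
   real-valued norm of x is re `|x|. *)
Section BishopPhelpsBollobas.
Context (R : realType) (K : numFieldType) (re : K -> R) (X : normedModType K).

Definition dual : set {linear X -> K^o} := [set f | continuous f].

Definition unit_ball : set X := [set x | re `|x| <= 1].
Definition unit_sphere : set X := [set x | re `|x| = 1].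

(* For a continuous functional the set below is bounded and nonempty, hence
   sup is a genuine supremum. *)
Definition dual_norm (f : X -> K^o) : R :=
  sup [set re `|f x| | x in unit_ball].

Definition dual_unit_ball : set {linear X -> K^o} :=
  dual `&` [set f | dual_norm f <= 1].
Definition dual_unit_sphere : set {linear X -> K^o} :=
  dual `&` [set f | dual_norm f = 1].

Definition Pi_pairs : set (X * {linear X -> K^o}) :=
  [set p | [/\ unit_sphere p.1, dual_unit_sphere p.2 & p.2 p.1 = 1]].

Definition BPB_admissible (D : set (X * {linear X -> K^o})) (delta eps : R) :
    Prop :=
  forall x f, D (x, f) -> 1 - delta < re (f x) ->
    exists y g, [/\ Pi_pairs (y, g), re `|x - y| < eps
                  & dual_norm (f \- g) < eps].

(* The infimum is taken in the extended reals, so that it is +oo, and not the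
   default value 0, on the empty set. *)
Definition BPB_modulus_on (D : set (X * {linear X -> K^o})) (delta : R) :
    \bar R :=
  ereal_inf [set eps%:E | eps in [set eps | 0 < eps /\
                                            BPB_admissible D delta eps]].

Definition BPB_modulus : R -> \bar R :=
  BPB_modulus_on (unit_ball `*` dual_unit_ball).

Definition spherical_BPB_modulus : R -> \bar R :=
  BPB_modulus_on (unit_sphere `*` dual_unit_sphere).

End BishopPhelpsBollobas.

(* Main.v *)
(** Let [a] be the norm of the functional [f], [s = sqrt (2 delta)],
[t = 1 - a] and [k = (s - t) / 2]. Ekeland's principle for [f] on the unit
ball gives [y] with [f x + k |y - x| <= f y] that is strictly maximal for the
order defined by the slope [k]; a Hahn-Banach sandwich between [f] on the cone
generated by [ball - y] and [k |.|] turns it into [g] with [|f - g| <= k]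
attaining its norm at [y]. Then [|x - y| <= (delta - t) / k <= s], and
normalizing [g] costs at most [t + k], hence [2k + t = s] in total. If
[k >= a], then [g] might vanish, but [1 + a <= s], so any unit vector within
distance 1 of [x] and any functional supporting the ball there will do.
Complex functionals are determined by their real parts, with the same norm.

Hahn-Banach itself follows from Zorn's lemma: a minimal sublinear functional
is linear. *)

Require Import Defs.
From HB Require Import structures.
From mathcomp Require Import all_boot all_order all_algebra.
From mathcomp Require Import all_classical all_reals all_analysis.
From mathcomp Require Import complex.
From mathcomp Require Import ring lra.

Import Order.TTheory GRing.Theory Num.Theory.
Import numFieldNormedType.Exports.

Local Open Scope classical_set_scope.
Local Open Scope ring_scope.

(** * Sublinear functionals *)

Definition sublinear {R : realType} {V : lmodType R} (p : V -> R) : Prop :=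
  (forall u v, p (u + v) <= p u + p v) /\
  (forall t u, 0 < t -> p (t *: u) = t * p u).

Lemma sublinear0 {R : realType} {V : lmodType R} {p : V -> R} :
  sublinear p -> p 0 = 0.
Proof.
by move=> [_ pZ]; have := pZ 2 0; rewrite scaler0 => /(_ ltac:(lra)); lra.
Qed.

Lemma sublinear_ge {R : realType} {V : lmodType R} {p : V -> R} (u : V) :
  sublinear p -> - p (- u) <= p u.
Proof.
by move=> sp; have := sp.1 u (- u); rewrite subrr (sublinear0 sp); lra.
Qed.

(* A convex cone C of pairs (c, r) is read as a superlinear minorant
   "r <= h c" imposed on a functional h dominated by p. *)
Definition minorant_cone {R : realType} {V : lmodType R} (p : V -> R)
    (C : set (V * R)) : Prop :=
  [/\ C (0, 0),
      forall c r d s, C (c, r) -> C (d, s) -> C (c + d, r + s),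
      forall t c r, 0 < t -> C (c, r) -> C (t *: c, t * r)
    & forall c r, C (c, r) -> r <= p c].

(** A linear [h] lies below [cone_inf p C] exactly when [h <= p] and [r <= h c] for all [(c, r)] in
    [C], so both constraints of the sandwich become domination by one sublinear functional. *)
Definition cone_inf {R : realType} {V : lmodType R} (p : V -> R)
    (C : set (V * R)) (u : V) : R :=
  inf [set p (u + cr.1) - cr.2 | cr in C].

Section ConeInf.
Context {R : realType} {V : lmodType R} {p : V -> R} {C : set (V * R)}.
Hypotheses (sp : sublinear p) (pC : minorant_cone p C).

(** From [r <= p c <= p (u + c) + p (- u)]. It makes [inf] in [cone_inf] a genuine infimum. *)
Let lb (u : V) : lbound [set p (u + cr.1) - cr.2 | cr in C] (- p (- u)).
Proof.
have [_ _ _ leC] := pC.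
move=> _ [[c r] Ccr <-] /=; have := sp.1 (u + c) (- u).
by rewrite addrAC subrr add0r; have := leC _ _ Ccr; lra.
Qed.

Lemma cone_inf_le u c r : C (c, r) -> cone_inf p C u <= p (u + c) - r.
Proof.
by move=> Ccr; apply: ge_inf; [exists (- p (- u)); exact: lb|exists (c, r)].
Qed.

Lemma cone_inf_ge u a :
  (forall c r, C (c, r) -> a <= p (u + c) - r) -> a <= cone_inf p C u.
Proof.
have [C0 _ _ _] := pC.
move=> le; apply: lb_le_inf; first by exists (p (u + 0) - 0), (0, 0).
by move=> _ [[c r] Ccr <-]; exact: le.
Qed.

Lemma cone_inf_le_self u : cone_inf p C u <= p u.
Proof.
by have [C0 _ _ _] := pC; have := cone_inf_le u _ _ C0; rewrite addr0 subr0.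
Qed.

Lemma cone_inf_cone c r : C (c, r) -> cone_inf p C (- c) <= - r.
Proof.
by move=> /(cone_inf_le (- c)); rewrite addNr (sublinear0 sp) sub0r.
Qed.

Lemma sublinear_cone_inf : sublinear (cone_inf p C).
Proof.
have [C0 CD CZ _] := pC.
(* The reverse inequality is this one for [t^-1] and [t *: u]. *)
have leZ t u : 0 < t -> t * cone_inf p C u <= cone_inf p C (t *: u).
  move=> t0; apply: cone_inf_ge => c r Ccr.
  have := cone_inf_le u _ _ (CZ t^-1 _ _ _ Ccr); rewrite invr_gt0 => /(_ t0).
  rewrite -(ler_pM2l t0) mulrBr mulrA divff ?gt_eqF// mul1r.
  by rewrite -sp.2// scalerDr scalerA divff ?gt_eqF// scale1r.
split=> [u v|t u t0].
  rewrite -lerBlDl; apply: cone_inf_ge => d s Cds.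
  rewrite lerBlDl -lerBlDr; apply: cone_inf_ge => c r Ccr.
  have := cone_inf_le (u + v) _ _ (CD _ _ _ _ Ccr Cds).
  by have := sp.1 (u + c) (v + d); rewrite addrACA; lra.
apply/eqP; rewrite eq_le leZ// andbT.
have := leZ t^-1 (t *: u); rewrite invr_gt0 => /(_ t0).
by rewrite scalerA mulVf ?gt_eqF// scale1r ler_pdivrMl.
Qed.

End ConeInf.

(** Zorn's lemma for the reversed pointwise order. A nonempty chain is bounded by its pointwise
    infimum, which is subadditive because the smaller of two members of the chain can replace
    both. *)
Lemma sublinear_minimal {R : realType} {V : lmodType R} (p : V -> R) :
  sublinear p ->
  exists2 q, sublinear q /\ (forall u, q u <= p u) &
    forall q', sublinear q' -> (forall u, q' u <= q u) -> q' =1 q.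
Proof.
move=> sp.
pose T := {q : V -> R | sublinear q /\ (forall u, q u <= p u)}.
pose ge (q1 q2 : T) := `[< forall u, sval q2 u <= sval q1 u >].
have [||||[q [sq qp]] qmin] := @Zorn T ge.
- by move=> q; apply/asboolP.
- move=> q1 q2 q3 /asboolP le21 /asboolP le32; apply/asboolP => u.
  exact: le_trans (le32 u) (le21 u).
- move=> [q1 ?] [q2 ?] /asboolP /= le21 /asboolP /= le12; apply: eq_exist.
  by apply/funext => u; apply/eqP; rewrite eq_le le12 le21.
- move=> A Atot.
  have [[q0 Aq0]|A0] := pselect (exists q, A q); last first.
    (* The empty chain is bounded by [p] itself. *)
    exists (exist _ p (conj sp (fun u => lexx (p u)))) => q Aq.
    by exfalso; apply: A0; exists q.
  pose E u : set R := [set (sval q : V -> R) u | q in A].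
  have lbE u : lbound (E u) (- p (- u)).
    move=> _ [[q [sq qp]] Aq <-] /=.
    by have := qp (- u); have := sublinear_ge u sq; lra.
  have E0 u : E u !=set0 by exists (sval q0 u), q0.
  have infE q u : A q -> inf (E u) <= sval q u.
    by move=> Aq; apply: ge_inf; [exists (- p (- u))|exists q].
  have inf_sub : sublinear (fun u => inf (E u)).
    have leZ t u : 0 < t -> t * inf (E u) <= inf (E (t *: u)).
      move=> t0; apply: lb_le_inf => // _ [q Aq <-].
      by rewrite (svalP q).1.2// ler_pM2l//; exact: infE.
    split=> [u v|t u t0].
      rewrite -lerBlDl; apply: lb_le_inf => // _ [q1 Aq1 <-].
      rewrite lerBlDl -lerBlDr; apply: lb_le_inf => // _ [q2 Aq2 <-].
      have [/asboolP le|/asboolP le] := Atot _ _ Aq1 Aq2.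
        have := infE _ (u + v) Aq2; have := (svalP q2).1.1 u v.
        by have := le v; lra.
      have := infE _ (u + v) Aq1; have := (svalP q1).1.1 u v.
      by have := le u; lra.
    apply/eqP; rewrite eq_le leZ// andbT.
    have := leZ t^-1 (t *: u); rewrite invr_gt0 => /(_ t0).
    by rewrite scalerA mulVf ?gt_eqF// scale1r ler_pdivrMl.
  have inf_le u : inf (E u) <= p u.
    exact: le_trans (infE _ u Aq0) ((svalP q0).2 u).
  exists (exist _ (fun u => inf (E u)) (conj inf_sub inf_le)) => q Aq.
  by apply/asboolP => u /=; exact: infE.
exists q => // q' sq' q'q.
have q'p u : q' u <= p u by exact: le_trans (q'q u) (qp u).
have := qmin (exist _ q' (conj sq' q'p)).
by move=> /(_ ltac:(exact/asboolP)) /(congr1 (@sval _ _)) /= ->.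
Qed.

(* The cone_inf of q along the half-line through x is again sublinear and
   below q, so minimality makes q superadditive. *)
Lemma minimal_sublinear_scalar {R : realType} {V : lmodType R} (q : V -> R) :
  sublinear q ->
  (forall q', sublinear q' -> (forall u, q' u <= q u) -> q' =1 q) ->
  scalar q.
Proof.
move=> sq qmin.
have qD u x : q (u + x) = q u + q x.
  apply/eqP; rewrite eq_le sq.1/=.
  pose C : set (V * R) := [set cr | exists2 t, 0 <= t &
                                    cr = (t *: x, t * q x)].
  have qZ0 t : 0 <= t -> q (t *: x) = t * q x.
    rewrite le_eqVlt => /orP[/eqP<-|/sq.2//].
    by rewrite scale0r mul0r sublinear0.
  have qC : minorant_cone q C.
    split=> [|c r d s [t t0 [-> ->]] [t' t'0 [-> ->]]
      |t c r t0 [t' t'0 [-> ->]]|].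
    - by exists 0; rewrite ?scale0r ?mul0r.
    - by exists (t + t'); rewrite ?addr_ge0// scalerDl mulrDl.
    - by exists (t * t'); rewrite ?scalerA ?mulrA// mulr_ge0// ltW.
    - by move=> c r [t t0 [-> ->]]; rewrite qZ0.
  have Cx : C (x, q x) by exists 1; rewrite ?scale1r ?mul1r.
  have := cone_inf_le sq qC u _ _ Cx.
  rewrite (qmin _ (sublinear_cone_inf sq qC) (cone_inf_le_self sq qC)); lra.
have qN u : q (- u) = - q u.
  by have := qD u (- u); rewrite subrr (sublinear0 sq); lra.
move=> t u v; rewrite qD; congr (_ + _).
have [t0|t0|<-] := ltgtP 0 t; first exact: sq.2.
  by rewrite -{1}[t]opprK scaleNr qN sq.2 ?oppr_gt0// mulNr opprK.
by rewrite scale0r mul0r (sublinear0 sq).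
Qed.

(** Any minimal sublinear [h] below [cone_inf p C] is linear, and [h (- c) <= - r] turns into
    [r <= h c] by linearity. *)
Theorem hahn_banach_sandwich {R : realType} {V : lmodType R} (p : V -> R)
    (C : set (V * R)) :
  sublinear p -> minorant_cone p C ->
  exists h : V -> R, [/\ scalar h, forall u, h u <= p u &
    forall c r, C (c, r) -> r <= h c].
Proof.
move=> sp pC.
have [h [sh hq] hmin] := sublinear_minimal _ (sublinear_cone_inf sp pC).
have lh := minimal_sublinear_scalar _ sh hmin.
exists h; split=> // [u|c r Ccr].
  exact: le_trans (hq u) (cone_inf_le_self sp pC u).
have hN : h (- c) = - h c.
  by have := lh (-1) c 0; rewrite scaleN1r !addr0 (sublinear0 sh); lra.
by have := hq (- c); have := cone_inf_cone sp pC _ _ Ccr; lra.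
Qed.

(** * Real Banach spaces *)

(* The norm is a function on a real vector space rather than a library normed
   module, so that complex spaces enter through restriction of scalars. *)
Record banach_norm {R : realType} {V : lmodType R} (N : V -> R) : Prop := {
  banach_normD : forall u v, N (u + v) <= N u + N v ;
  banach_normZ : forall t u, N (t *: u) = `|t| * N u ;
  banach_norm_eq0 : forall u, N u = 0 -> u = 0 ;
  banach_norm_complete : forall x_ : nat -> V,
    (forall e, 0 < e -> exists n, forall m, (n <= m)%N ->
       N (x_ m - x_ n) < e) ->
    exists l, forall e, 0 < e -> exists n, forall m, (n <= m)%N ->
       N (x_ m - l) < e }.

Arguments banach_normD {R V N}.
Arguments banach_normZ {R V N}.
Arguments banach_norm_eq0 {R V N}.
Arguments banach_norm_complete {R V N}.

Section BanachNorm.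
Context {R : realType} {V : lmodType R} {N : V -> R}.
Hypothesis bN : banach_norm N.
Implicit Types (f g h : V -> R) (x y z u v : V) (a e k t : R).

Let ND := banach_normD bN.
Let NZ := banach_normZ bN.

Lemma banach_norm0 : N 0 = 0.
Proof. by rewrite -(scale0r 0) NZ normr0 mul0r. Qed.

Lemma banach_normN u : N (- u) = N u.
Proof. by rewrite -scaleN1r NZ normrN1 mul1r. Qed.

Lemma banach_norm_ge0 u : 0 <= N u.
Proof. by have := ND u (- u); rewrite subrr banach_norm0 banach_normN; lra. Qed.

Lemma banach_norm_dist_sym u v : N (u - v) = N (v - u).
Proof. by rewrite -banach_normN opprB. Qed.

Lemma banach_norm_normalize u : u <> 0 -> N ((N u)^-1 *: u) = 1.
Proof.
move=> u0; have Nu : N u != 0 by apply/eqP => /(banach_norm_eq0 bN).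
by rewrite NZ ger0_norm ?invr_ge0 ?banach_norm_ge0// mulVf.
Qed.

Lemma sublinear_banach_norm k : 0 <= k -> sublinear (fun u => k * N u).
Proof.
move=> k0; split=> [u v|t u t0]; first by rewrite -mulrDr ler_wpM2l.
by rewrite NZ gtr0_norm// mulrCA.
Qed.

(** Starting at [x], each term of a sequence is a successor of the previous one at which [f] is
    nearly as large as on any other successor. The sequence converges, and nothing but its limit can
    succeed its limit. *)
Lemma ekeland (S : set V) (f : V -> R) (a M k : R) (x : V) :
  (forall l, (forall e, 0 < e -> exists2 z, S z & N (z - l) < e) -> S l) ->
  0 <= a -> (forall u v, f u - f v <= a * N (u - v)) ->
  (forall u, S u -> f u <= M) -> 0 < k -> S x ->
  exists y, [/\ S y, f x + k * N (y - x) <= f y &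
    forall z, S z -> f y + k * N (z - y) <= f z -> z = y].
Proof.
move=> Sclosed a0 flip fM k0 Sx.
pose succ u z := S z /\ f u + k * N (z - u) <= f z.
have succ_refl u : S u -> succ u u.
  by move=> Su; split; rewrite // subrr banach_norm0 mulr0 addr0.
have succ_trans u v w : succ u v -> succ v w -> succ u w.
  move=> [_ uv] [Sw vw]; split=> //.
  have : k * N (w - u) <= k * N (v - u) + k * N (w - v).
    by rewrite -mulrDr ler_pM2l// -[w - u](subrKA v) [leRHS]addrC ND.
  lra.
have [eps eps_gt0 small] : exists2 eps : nat -> R, forall n, 0 < eps n &
    forall e, 0 < e -> exists n, eps n < e.
  exists (fun n => n.+1%:R^-1) => [n|e /ltr_add_invr[n]].
    by rewrite invr_gt0.
  by rewrite add0r; exists n.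
(* [next (n, u)] comes within [eps n] of the supremum of [f] over the successors of [u]; outside [S]
   its value is arbitrary. *)
have /choice[next nextP] (nu : nat * V) : exists z, S nu.2 ->
    succ nu.2 z /\ forall w, succ nu.2 w -> f w <= f z + eps nu.1.
  have [Su|] := pselect (S nu.2); last by exists 0.
  have supE : has_sup [set f w | w in succ nu.2].
    split; first by exists (f nu.2), nu.2 => //; exact: succ_refl.
    by exists M => _ [w [Sw _] <-]; exact: fM.
  have [_ [z nuz <-] supz] := sup_adherent (eps_gt0 nu.1) supE.
  exists z => _; split=> // w nuw.
  have : f w <= sup [set f w | w in succ nu.2].
    by apply: sup_upper_bound => //; exists w.
  by move=> /le_trans; apply; rewrite -lerBlDr ltW.
pose x_ := fix x_ n := if n is m.+1 then next (m, x_ m) else x.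
have Sx_ n : S (x_ n) by elim: n => //= n /(nextP (n, x_ n))[[]].
have stepP n : succ (x_ n) (x_ n.+1) /\
    forall w, succ (x_ n) w -> f w <= f (x_ n.+1) + eps n.
  exact: nextP (n, x_ n) (Sx_ n).
have succ_x n m : (n <= m)%N -> succ (x_ n) (x_ m).
  move=> /subnK <-; elim: (m - n)%N => [|d IH]; first exact: succ_refl.
  exact: succ_trans IH (stepP _).1.
have [|y x_y] := banach_norm_complete bN x_.
  (* Passing from [x_ n.+1] to [x_ m] gains at least [k] times their distance, but at most [eps n],
     since [x_ m] also succeeds [x_ n]. *)
  move=> e e0; have [n ne] := small _ (mulr_gt0 k0 e0).
  exists n.+1 => m nm; rewrite -(ltr_pM2l k0).
  have [_ xm] := succ_x _ _ nm.
  by have := (stepP n).2 _ (succ_x _ _ (ltnW nm)); lra.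
have Sy : S y.
  apply: Sclosed => e /x_y[n xn]; exists (x_ n) => //; exact: xn.
have succ_y n : succ (x_ n) y.
  split=> //; apply/ler_addgt0Pr => e e0.
  (* Replacing a late term [z] by the limit [y] costs [a * N (z - y)] in [f] and [k * N (z - y)] in
     the distance term. *)
  have ak : 0 < a + k by lra.
  have [m xm] := x_y _ (divr_gt0 e0 ak).
  have {xm} := xm _ (leq_maxl m n).
  have [_] := succ_x n _ (leq_maxr m n); set z := x_ (maxn m n) => xz.
  rewrite ltr_pdivlMr// => ze.
  have := flip z y; have : k * N (y - x_ n) <= k * (N (z - x_ n) + N (z - y)).
    rewrite ler_pM2l//; have := ND (y - z) (z - x_ n).
    by rewrite subrKA (banach_norm_dist_sym y z); lra.
  lra.
exists y; split=> //; first by have [] := succ_y 0%N.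
move=> z Sz yz; apply/eqP; rewrite -subr_eq0; apply/eqP/(banach_norm_eq0 bN).
(* A successor [z] of [y] succeeds every [x_ n], so [f z] exceeds [f (x_ n.+1)], and hence [f y], by
   at most [eps n]. *)
have fzy : f z <= f y.
  apply/ler_addgt0Pr => e /small[n ne].
  have := (stepP n).2 _ (succ_trans _ _ _ (succ_y n) (conj Sz yz)).
  have [_] := succ_y n.+1.
  have := mulr_ge0 (ltW k0) (banach_norm_ge0 (y - x_ n.+1)).
  lra.
have : k * N (z - y) <= 0 by lra.
by rewrite pmulr_rle0// => Nzy; apply/eqP; rewrite eq_le Nzy/= banach_norm_ge0.
Qed.

Lemma bishop_phelps (f : V -> R) (a k : R) (x : V) :
  scalar f -> 0 <= a -> (forall u, f u <= a * N u) -> 0 < k -> N x <= 1 ->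
  exists y g, [/\ N y <= 1, f x + k * N (y - x) <= f y, scalar g,
    forall u, f u - g u <= k * N u & forall z, N z <= 1 -> g z <= g y].
Proof.
move=> lf a0 fa k0 Nx.
have fD u v : f (u + v) = f u + f v by rewrite -{1}[u]scale1r lf mul1r.
have f0 : f 0 = 0 by have := fD 0 0; rewrite addr0; lra.
have fZ t u : f (t *: u) = t * f u by rewrite -[t *: u]addr0 lf f0 addr0.
have fB u v : f (u - v) = f u - f v by rewrite fD -scaleN1r fZ mulN1r.
have [|||y [/= Ny xy ymax]] :=
  @ekeland [set z | N z <= 1] f a a k x _ a0 _ _ k0 Nx.
- move=> l lcl; apply/ler_addgt0Pr => e /lcl[z /= Nz zl].
  by have := ND (l - z) z; rewrite subrK banach_norm_dist_sym; lra.
- by move=> u v; rewrite -fB.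
- move=> u /= Nu; have := ler_wpM2l a0 Nu; have := fa u; lra.
(* Otherwise [z] would succeed [y], hence equal [y], where both sides vanish. *)
have steep z : N z <= 1 -> f (z - y) <= k * N (z - y).
  move=> Nz; rewrite leNgt; apply/negP => lt; have zy : z = y.
    by apply: ymax => //; move: lt; rewrite fB; lra.
  by move: lt; rewrite zy subrr f0 banach_norm0; lra.
(* Writing [t *: (z - y)] as [w - t *: y] with [N w <= t] reduces closure under addition to the
   triangle inequality. *)
pose C : set (V * R) := [set cr | exists t w, [/\ 0 <= t, N w <= t,
  cr.1 = w - t *: y & cr.2 = f cr.1]].
have kC : minorant_cone (fun u => k * N u) C.
  split.
  - by exists 0, 0; rewrite /= scale0r subr0 banach_norm0 f0.
  - move=> c r d s [t [w [t0 wt /= -> ->]]] [t' [w' [t'0 wt' /= -> ->]]].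
    exists (t + t'), (w + w'); rewrite /= -fD; split=> //.
    + exact: addr_ge0.
    + by apply: le_trans (ND _ _) _; exact: lerD.
    + by rewrite scalerDl opprD addrACA.
  - move=> t c r t0 [t' [w [t'0 wt' /= -> ->]]].
    exists (t * t'), (t *: w); rewrite /= -fZ; split=> //.
    + by rewrite mulr_ge0// ltW.
    + by rewrite NZ gtr0_norm// ler_pM2l.
    + by rewrite scalerBr scalerA.
  - move=> c r [t [w [t0 wt /= -> ->]]].
    move: t0; rewrite le_eqVlt => /orP[/eqP t0|t0].
      have -> : w = 0.
        apply: (banach_norm_eq0 bN); have := banach_norm_ge0 w; lra.
      by rewrite -t0 scale0r subr0 f0 banach_norm0 mulr0.
    have -> : w - t *: y = t *: (t^-1 *: w - y).
      by rewrite scalerBr scalerA divff ?gt_eqF// scale1r.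
    rewrite fZ NZ gtr0_norm// mulrCA ler_pM2l// steep//.
    by rewrite NZ gtr0_norm ?invr_gt0// ler_pdivrMl// mulr1.
have [h [lh hk hC]] :=
  hahn_banach_sandwich _ _ (sublinear_banach_norm _ (ltW k0)) kC.
have hD u v : h (u + v) = h u + h v by rewrite -{1}[u]scale1r lh mul1r.
(* Here [h <= k N] bounds [f - g], and [f (z - y) <= h (z - y)] says that [g z <= g y]. *)
exists y, (fun u => f u - h u); split=> // [|u|z Nz].
- by move=> t u v; rewrite lf lh; ring.
- by rewrite opprB addrC subrK.
- have /hC : C (z - y, f (z - y)).
    by exists 1, z; rewrite ler01 /= scale1r.
  have -> : h (z - y) = h z - h y.
    rewrite hD; have := hD y (- y); have := lh 1 0 0.
    by rewrite subrr scaler0 addr0; lra.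
  by rewrite fB; lra.
Qed.

(** Sandwich between the norm and the half-line through [y], on which [t *: y] has the prescribed
    lower bound [t]. *)
Lemma support_functional (y : V) : N y = 1 ->
  exists g, [/\ scalar g, forall u, g u <= N u & g y = 1].
Proof.
move=> Ny.
pose C : set (V * R) := [set cr | exists2 t, 0 <= t & cr = (t *: y, t)].
have NC : minorant_cone (fun u => 1 * N u) C.
  split=> [|c r d s [t t0 [-> ->]] [t' t'0 [-> ->]]|t c r t0 [t' t'0 [-> ->]]|].
  - by exists 0; rewrite ?scale0r.
  - by exists (t + t'); rewrite ?addr_ge0// scalerDl.
  - by exists (t * t'); rewrite ?scalerA// mulr_ge0// ltW.
  - by move=> c r [t t0 [-> ->]]; rewrite mul1r NZ ger0_norm// Ny mulr1.
have [g [lg gN gC]] :=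
  hahn_banach_sandwich _ _ (sublinear_banach_norm _ ler01) NC.
exists g; split=> // [u|]; first by have := gN u; rewrite mul1r.
apply/eqP; rewrite eq_le; apply/andP; split.
  by have := gN y; rewrite mul1r Ny.
by apply: gC; exists 1; rewrite ?scale1r.
Qed.

Lemma real_bishop_phelps_bollobas (f : V -> R) (a s delta : R) (x : V) :
  scalar f -> 0 <= a <= 1 -> (forall u, f u <= a * N u) ->
  (forall e, 0 < e -> exists2 z, N z <= 1 & a - e < f z) ->
  (exists u : V, u <> 0) ->
  0 < s < 2 -> s ^+ 2 = 2 * delta ->
  N x <= 1 -> 1 - delta < f x ->
  exists y g, [/\ scalar g, N y = 1, g y = 1, forall u, g u <= N u &
    N (x - y) <= s /\ forall u, f u - g u <= s * N u].
Proof.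
move=> lf /andP[a0 a1] fa fsup [u0 u0_neq0] /andP[s0 s2] sE Nx fx.
have N0 := banach_norm_ge0.
have fxa : f x <= a by have := fa x; have := ler_wpM2l a0 Nx; lra.
pose k := (s - (1 - a)) / 2.
(* From [1 - delta < f x <= a] one gets [1 - a < delta = s ^+ 2 / 2 < s], the last step because
   [s < 2]. *)
have k0 : 0 < k by rewrite /k; nra.
have scalarN g : scalar g -> forall u, g (- u) = - g u.
  move=> lg u; have := lg (-1) u 0; have := lg (-1) 0 0.
  by rewrite !scaleN1r oppr0 !addr0; lra.
have [ak|ka] := leP a k.
  have s1a : 1 + a <= s by move: ak; rewrite /k; lra.
  have [y Ny xy] : exists2 y, N y = 1 & N (x - y) <= 1.
    have [->|/eqP x0] := eqVneq x 0.
      exists ((N u0)^-1 *: u0); first exact: banach_norm_normalize.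
      by rewrite sub0r banach_normN banach_norm_normalize.
    exists ((N x)^-1 *: x); first exact: banach_norm_normalize.
    have Nx0 : 0 < N x.
      rewrite lt_neqAle N0 andbT eq_sym.
      by apply/eqP => /(banach_norm_eq0 bN).
    rewrite -[X in N (X - _)]scale1r -scalerBl NZ -[X in _ * X]gtr0_norm//.
    rewrite -normrM mulrBl mul1r mulVf ?gt_eqF// ler_norml; lra.
  have [g [lg gN gy]] := support_functional _ Ny.
  exists y, g; split=> //; split; first by lra.
  move=> u; have := fa u; have := gN (- u).
  rewrite banach_normN (scalarN _ lg).
  have := ler_wpM2r (N0 u) s1a; lra.
have [y [g [Ny xy lg fg gy]]] := bishop_phelps _ _ _ _ lf a0 fa k0 Nx.
(* [g y] is the norm of [g], so it differs from [a] by at most [k]; it is positive as [k < a] in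
   this case. *)
have b_ge : a - k <= g y.
  apply/ler_addgt0Pr => e /fsup[z Nz fz].
  have := ler_wpM2l (ltW k0) Nz; have := fg z; have := gy _ Nz; lra.
have b_le : g y <= a + k.
  have := fg (- y); rewrite (scalarN _ lf) (scalarN _ lg) banach_normN.
  by have := fa y; have := ler_wpM2l a0 Ny; have := ler_wpM2l (ltW k0) Ny; lra.
have b0 : 0 < g y by lra.
have g0 : g 0 = 0 by have := scalarN _ lg 0; rewrite oppr0; lra.
have gZ t u : g (t *: u) = t * g u by rewrite -[t *: u]addr0 lg g0 addr0.
have gN u : g u <= g y * N u.
  have [->|/eqP/banach_norm_normalize Nu] := eqVneq u 0.
    by rewrite g0 banach_norm0 mulr0.
  have Nu0 : 0 < N u.
    rewrite lt_neqAle N0 andbT eq_sym; apply/eqP => Nu0.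
    by move: Nu; rewrite Nu0 invr0 scale0r banach_norm0; lra.
  have := gy ((N u)^-1 *: u); rewrite Nu lexx gZ => /(_ isT).
  by rewrite ler_pdivrMl// mulrC.
have gabs u : `|g u| <= g y * N u.
  by rewrite ler_norml gN andbT lerNl -(scalarN _ lg) -[N u]banach_normN gN.
have Ny1 : N y = 1.
  apply/eqP; rewrite eq_le Ny/=.
  by have := gN y; rewrite -{1}[g y]mulr1 ler_pM2l.
exists y, (fun u => (g y)^-1 * g u); split=> //.
- by move=> t u v; rewrite lg; ring.
- by rewrite mulVf ?gt_eqF.
- by move=> u; rewrite ler_pdivrMl.
split.
  rewrite banach_norm_dist_sym -(ler_pM2l k0).
  have := fa y; rewrite Ny1.
  (* Indeed [k * s = delta - (1 - a) * s / 2], with [s < 2] and [a <= 1]. *)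
  have : delta - (1 - a) <= k * s by rewrite /k; nra.
  lra.
move=> u.
(* The cost of normalizing is [|g y - 1|] times [|g u| / g y <= N u], and [g y] lies between [a - k]
   and [a + k] with [a <= 1]. *)
have : (1 - (g y)^-1) * g u <= (1 - a + k) * N u.
  apply: le_trans (ler_norm _) _; rewrite normrM.
  have -> : 1 - (g y)^-1 = (g y - 1) / g y by field; rewrite gt_eqF.
  rewrite normrM normfV (gtr0_norm b0) -mulrA.
  apply: ler_pM => //.
  - by rewrite mulr_ge0// invr_ge0 ltW.
  - by rewrite ler_norml; lra.
  - by rewrite ler_pdivrMl.
have := fg u.
have : (k + (1 - a + k)) * N u = s * N u by rewrite /k; congr (_ * _); field.
lra.
Qed.

End BanachNorm.

(** * Restriction of scalars *)

(* The common interface of R and R[i] as scalar fields over R. *)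
Record real_scalars {R : realType} {K : numFieldType}
    (emb : {rmorphism R -> K}) (re : K -> R) : Prop := {
  reD : forall z w, re (z + w) = re z + re w ;
  reZ : forall t z, re (emb t * z) = t * re z ;
  re1 : re 1 = 1 ;
  emb_ge0 : forall t, 0 <= t -> 0 <= emb t ;
  emb_re : forall z, 0 <= z -> emb (re z) = z ;
  re_le_norm : forall z, re z <= re `|z| ;
  re_norm_eq1 : forall z, re `|z| <= 1 -> re z = 1 -> z = 1 ;
  rotation : forall z : K, exists2 u, `|u| = 1 & u * z = `|z| ;
  re_functional : forall (X : lmodType K) (g : X -> R),
    (forall u v, g (u + v) = g u + g v) ->
    (forall t u, g (emb t *: u) = t * g u) ->
    exists G : {linear X -> K^o}, forall u, re (G u) = g u }.

Arguments reD {R K emb re}.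
Arguments reZ {R K emb re}.
Arguments re1 {R K emb re}.
Arguments emb_ge0 {R K emb re}.
Arguments emb_re {R K emb re}.
Arguments re_le_norm {R K emb re}.
Arguments re_norm_eq1 {R K emb re}.
Arguments rotation {R K emb re}.
Arguments re_functional {R K emb re}.

(** A separate name for [X], indexed by [emb], so that its structure over [R] does not compete with
    the one over [K]. *)
Definition restriction {R : realType} {K : numFieldType}
  (emb : {rmorphism R -> K}) (X : lmodType K) : Type := X.

Section Restriction.
Context {R : realType} {K : numFieldType} (emb : {rmorphism R -> K}).
Context (X : lmodType K).

HB.instance Definition _ := GRing.Zmodule.on (restriction emb X).

Let scale (t : R) (u : restriction emb X) : restriction emb X :=
  emb t *: (u : X).

Let scaleA s t u : scale s (scale t u) = scale (s * t) u.
Proof. by rewrite /scale scalerA rmorphM. Qed.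

Let scale1 : left_id 1 scale.
Proof. by move=> u; rewrite /scale rmorph1 scale1r. Qed.

Let scaleDr : right_distributive scale +%R.
Proof. by move=> t u v; rewrite /scale scalerDr. Qed.

Let scaleDl u : {morph scale^~ u : s t / s + t}.
Proof. by move=> s t; rewrite /scale rmorphD scalerDl. Qed.

HB.instance Definition _ :=
  GRing.Zmodule_isLmodule.Build R (restriction emb X)
    scaleA scale1 scaleDr scaleDl.

Lemma restriction_scaleE (t : R) (u : restriction emb X) :
  t *: u = (emb t *: (u : X) : restriction emb X).
Proof. by []. Qed.

End Restriction.

Section RealScalars.
Context {R : realType} {K : numFieldType} {emb : {rmorphism R -> K}}.
Context {re : K -> R}.
Hypothesis RK : real_scalars emb re.

Lemma re_emb t : re (emb t) = t.
Proof. by rewrite -[emb t]mulr1 (reZ RK) (re1 RK) mulr1. Qed.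

Lemma re_0 : re 0 = 0.
Proof. by rewrite -(rmorph0 emb) re_emb. Qed.

Lemma reB z w : re (z - w) = re z - re w.
Proof. by have := reD RK (z - w) w; rewrite subrK; lra. Qed.

Lemma emb_le s t : (emb s <= emb t) = (s <= t).
Proof.
have mono a b : a <= b -> emb a <= emb b.
  by move=> ab; rewrite -subr_ge0 -rmorphB (emb_ge0 RK)// subr_ge0.
have [/mono//|/[dup] lt /ltW/mono le] := leP s t.
apply/negP => le'; have /fmorph_inj e : emb s = emb t by apply/le_anti/andP.
by move: lt; rewrite e ltxx.
Qed.

Lemma re_le z w : 0 <= z -> 0 <= w -> (re z <= re w) = (z <= w).
Proof. by move=> z0 w0; rewrite -emb_le !(emb_re RK). Qed.

Lemma re_ge0 z : 0 <= z -> 0 <= re z.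
Proof. by move=> z0; rewrite -re_0 re_le. Qed.

Lemma re_lt z w : 0 <= z -> 0 <= w -> (re z < re w) = (z < w).
Proof. by move=> z0 w0; rewrite !lt_neqAle !eq_le !re_le. Qed.

Lemma reM z w : 0 <= z -> re (z * w) = re z * re w.
Proof. by move=> z0; rewrite -{1}(emb_re RK _ z0) (reZ RK). Qed.

Lemma norm_emb t : re `|emb t| = `|t|.
Proof.
have [t0|t0] := leP 0 t; first by rewrite !ger0_norm ?re_emb ?(emb_ge0 RK).
rewrite -normrN -rmorphN -[`|t|]normrN.
by rewrite !ger0_norm ?re_emb ?(emb_ge0 RK) ?oppr_ge0 ?ltW.
Qed.

(** [re] and [emb] match the positive radii of [K] with those of [R], so Cauchy sequences and limits
    are the same for both norms. *)
Lemma banach_norm_restriction (X : completeNormedModType K) :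
  banach_norm (fun u : restriction emb X => re `|u : X|).
Proof.
split.
- move=> u v; rewrite -(reD RK) re_le ?addr_ge0//; exact: ler_normD.
- by move=> t u; rewrite restriction_scaleE normrZ reM// norm_emb.
- move=> u u0; apply/eqP; rewrite -normr_eq0 -(emb_re RK `|u : X|)//.
  by rewrite u0 rmorph0.
move=> x_ x_cauchy.
pose y_ : nat -> X := x_.
have /cvg_ex[l /= yl] : cvg (y_ @ \oo).
  apply/cauchy_cvgP/cauchy_exP => e e0.
  have re_e0 : 0 < re e by rewrite -re_0 re_lt// ltW.
  have [n xn] := x_cauchy _ re_e0; exists (y_ n).
  exists n => // m /= nm; rewrite -ball_normE /=.
  by rewrite -re_lt// ?ltW// (distrC (y_ n)); exact: xn _ nm.
exists l => e e0.
have emb_e0 : 0 < emb e.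
  by rewrite -re_lt ?(emb_ge0 RK) ?re_0 ?re_emb// ltW.
move/cvgrPdist_lt: yl => /(_ _ emb_e0)[n _ yn]; exists n => m nm.
rewrite -[e]re_emb; change (re `|y_ m - l| < re (emb e)).
by rewrite re_lt// ?ltW// distrC; exact: yn _ nm.
Qed.

(** * The dual norm and real parts of functionals *)

Section DualNorm.
Context {X : normedModType K}.
Implicit Types (f : {linear X -> K^o}) (u : X) (a : R).

Let N u : R := re `|u|.

Lemma dual_norm_le (F : X -> K^o) a :
  (forall u, N u <= 1 -> re `|F u| <= a) -> dual_norm re F <= a.
Proof.
move=> Fa; apply: ge_sup.
  by exists (re `|F 0|), 0 => //=; rewrite /unit_ball /= normr0 re_0.
by move=> _ [u u1 <-]; exact: Fa.
Qed.

(** Continuity bounds [f] on the unit ball, so that [sup] is a genuine supremum; it is then compared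
    with the value at [u] normalized. *)
Lemma le_dual_norm f u : dual f -> re `|f u| <= dual_norm re f * N u.
Proof.
move=> cf.
have [r r0 fr] : exists2 r : K, 0 < r & forall u, `|f u| <= r * `|u|.
  apply: (@pinfty_ex_gt0 K [set r | forall u, `|f u| <= r * `|u|]).
  by apply/linear_boundedP; apply/linear_bounded_continuous.
have [->|u0] := eqVneq u 0; first by rewrite linear0 /N !normr0 re_0 mulr0.
have Nu0 : 0 < `|u| by rewrite normr_gt0.
have /ub_le_sup : has_ubound [set re `|f u| | u in unit_ball re (X := X)].
  exists (re r) => _ [v v1 <-]; rewrite (re_le _ _ (normr_ge0 _) (ltW r0)).
  apply: le_trans (fr v) _; apply: ler_piMr; first exact: ltW.
  by rewrite -re_le// (re1 RK).
move=> /(_ (re `|f (`|u|^-1 *: u)|)) /= le.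
have {le} : re `|f (`|u|^-1 *: u)| <= dual_norm re f.
  apply: le; exists (`|u|^-1 *: u) => //=.
  by rewrite /unit_ball /= normrZ normfV normr_id mulVf ?gt_eqF// (re1 RK).
have N0 : 0 < N u by rewrite -re_0 re_lt.
rewrite linearZ /= normrZ normfV normr_id -(ler_pM2l N0).
rewrite [X in _ <= X -> _]mulrC.
by rewrite -reM ?normr_ge0// mulrA divff ?gt_eqF// mul1r.
Qed.

(** A scalar of modulus 1 turns [f u] into its modulus. This is why a functional and its real part
    have the same norm. *)
Lemma rotation_linear f u : exists2 v, N v = N u & re (f v) = re `|f u|.
Proof.
have [w w1 wf] := rotation RK (f u); exists (w *: u).
  by rewrite /N normrZ w1 mul1r.
by rewrite linearZ /= [w *: _]wf.
Qed.

Lemma linear_norm_le f a :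
  (forall u, re (f u) <= a * N u) -> forall u, re `|f u| <= a * N u.
Proof. by move=> fa u; have [v <- <-] := rotation_linear f u. Qed.

Lemma continuous_linear_norm_le f a :
  (forall u, re `|f u| <= a * N u) -> continuous f.
Proof.
move=> fa; apply/linear_bounded_continuous/linear_boundedP.
exists (emb a); split=> [|r /= /ltW ar u].
  by rewrite realE -!(rmorph0 emb) !emb_le -realE num_real.
apply: le_trans (ler_wpM2r (normr_ge0 u) ar).
by rewrite -(emb_re RK `|u|)// -rmorphM -(emb_re RK `|f u|)// emb_le.
Qed.

End DualNorm.

(** The general [D] covers the ball and sphere versions at once. *)
Theorem BPB_modulus_on_le (X : completeNormedModType K)
    (D : set (X * {linear X -> K^o})) (delta : R) :
  (forall p, D p -> (unit_ball re (X := X) `*` dual_unit_ball re (X := X)) p) ->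
  (exists x : X, x <> 0) -> 0 < delta -> delta < 2 ->
  (BPB_modulus_on re D delta <= (Num.sqrt (2 * delta))%:E)%E.
Proof.
move=> Dball X_neq0 delta0 delta2; set s := Num.sqrt (2 * delta).
have sE : s ^+ 2 = 2 * delta by rewrite sqr_sqrtr//; lra.
have s0 : 0 < s by rewrite sqrtr_gt0; lra.
have s2 : 0 < s < 2 by rewrite s0; nra.
(* The real theorem gives distances at most [s], while admissibility asks for strict inequalities;
   hence [s + e] for every [e > 0]. *)
apply/lee_addgt0Pr => e e0; rewrite -EFinD; apply: ereal_inf_lbound.
exists (s + e) => //=; split=> [|x f /Dball[/= Nx [cf f1]] fx]; first lra.
pose V := restriction emb X; pose N (u : V) := re `|u : X|.
have bN : banach_norm N := banach_norm_restriction X.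
pose a := dual_norm re f.
have fa (u : X) : re `|f u| <= a * N u by exact: le_dual_norm.
have rf_le (u : X) : re (f u) <= re `|f u| by exact: re_le_norm RK _.
have lf : scalar (fun u : V => re (f u)).
  move=> t u w; rewrite restriction_scaleE linearD linearZ /= (reD RK).
  by rewrite [_ *: f u]/(_ * f u) (reZ RK).
have a0 : 0 <= a.
  have [u /eqP] := X_neq0; rewrite -normr_gt0 => u0.
  have Nu0 : 0 < re `|u| by rewrite -re_0 re_lt.
  by rewrite -(pmulr_lge0 _ Nu0); apply: le_trans (fa u); exact: re_ge0.
have fsup e' : 0 < e' -> exists2 z : V, N z <= 1 & a - e' < re (f z).
  move=> e'0.
  have supE : has_sup [set re `|f u| | u in unit_ball re (X := X)].
    split; first by exists (re `|f x|), x.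
    exists a => _ [u /(ler_wpM2l a0) u1 <-].
    by apply: le_trans (fa u) _; rewrite mulr1 in u1.
  have [_ [u u1 <-] au] := sup_adherent e'0 supE.
  have [w Nw fw] := rotation_linear f u.
  by exists w; rewrite ?fw// /N Nw.
have a01 : 0 <= a <= 1 by rewrite a0.
have [y [g [lg Ny gy gN [xy fg]]]] := real_bishop_phelps_bollobas bN
  (fun u : V => re (f u)) a s delta x lf a01
  (fun u => le_trans (rf_le u) (fa u)) fsup X_neq0 s2 sE Nx fx.
rewrite /N /= in Ny xy.
have gD (u w : X) : g (u + w : X) = g u + g w.
  by have := lg 1 u w; rewrite scale1r mul1r.
have gZ t (u : X) : g (emb t *: u : X) = t * g u.
  have g0 : g 0 = 0 by have := gD 0 0; rewrite addr0; lra.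
  by have := lg t u 0; rewrite !addr0 g0 addr0.
have [G GE] := re_functional RK X g gD gZ.
have NG : forall u : X, re `|G u| <= 1 * re `|u|.
  by apply: linear_norm_le => u; rewrite GE mul1r gN.
(* The real part is 1 and the modulus at most 1, which leaves no imaginary part. *)
have G_y : G y = 1.
  by apply: (re_norm_eq1 RK); rewrite ?GE//; have := NG y; rewrite mul1r Ny.
exists y, G; split.
- split=> //; split; first exact: continuous_linear_norm_le NG.
  apply/eqP; rewrite eq_le; apply/andP; split.
    by apply: dual_norm_le => u u1; have := NG u; lra.
  have := @le_dual_norm X G y (continuous_linear_norm_le _ _ NG).
  by rewrite G_y normr1 (re1 RK) Ny mulr1.
- by apply: le_lt_trans xy _; rewrite ltrDl.
- apply: (@le_lt_trans _ _ s); last by rewrite ltrDl.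
  have fG : forall u : X, re `|(f \- G) u| <= s * re `|u|.
    by apply: linear_norm_le => u; rewrite /= reB GE; exact: fg.
  apply: dual_norm_le => u u1.
  by have := fG u; have := ler_wpM2l (ltW s0) u1; lra.
Qed.

End RealScalars.

(** * The real and the complex scalar fields *)

Lemma real_scalars_real (R : realType) :
  real_scalars (idfun : {rmorphism R -> R}) (@idfun R).
Proof.
split=> //=.
- exact: ler_norm.
- move=> z; have [z0|z0] := leP 0 z.
    by exists 1; rewrite ?normr1// mul1r ger0_norm.
  by exists (-1); rewrite ?normrN1// mulN1r ltr0_norm.
move=> X g gD gZ.
have lg : linear (g : X -> R^o) by move=> t u v; rewrite gD gZ.
pose G : {linear X -> R^o} :=
  HB.pack (g : X -> R^o) (GRing.isLinear.Build _ _ _ _ _ lg).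
by exists G.
Qed.

(** The complex functional with real part [g] is [g u - i g (i u)]. *)
Lemma complex_functional (R : realType) (X : lmodType R[i]) (g : X -> R) :
  (forall u v, g (u + v) = g u + g v) ->
  (forall t u, g (t%:C%C *: u) = t * g u) ->
  exists G : {linear X -> R[i]^o}, forall u, complex.Re (G u) = g u.
Proof.
move=> gD gZ.
pose G (u : X) : R[i]^o := (g u +i* - g ('i%C *: u))%C.
have lG : linear G.
  move=> [a b] u v.
  have gab w : g ((a +i* b)%C *: w) = a * g w + b * g ('i%C *: w).
    rewrite -!gZ -gD scalerA -scalerDl; congr (g (_ *: _)).
    by simpc.
  have gi w : g ('i%C *: ('i%C *: w)) = - g w.
    have -> : 'i%C *: ('i%C *: w) = (-1)%:C%C *: w.
      by rewrite scalerA; congr (_ *: _); simpc.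
    by rewrite gZ mulN1r.
  rewrite /G scalerDr !gD scalerA [_ * _]mulrC -scalerA !gab gi.
  apply/eqP; rewrite eq_complex /=; apply/andP; split; apply/eqP; ring.
pose H : {linear X -> R[i]^o} := HB.pack G (GRing.isLinear.Build _ _ _ _ _ lG).
by exists H.
Qed.

Lemma real_scalars_complex (R : realType) :
  real_scalars (real_complex R : {rmorphism R -> R[i]}) (@complex.Re R).
Proof.
split.
- by move=> [a b] [c d].
- by move=> t [a b] /=; ring.
- by [].
- by move=> t t0; rewrite lecE /= eqxx.
- by move=> z z0; apply: RRe_real; exact: ger0_real.
- move=> z; have := normc_ge_Re z; rewrite lecE => /andP[_ /=].
  exact/le_trans/ler_norm.
- move=> [a b]; rewrite normc_def /= => nz a1; move: nz; rewrite a1.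
  have ab0 : 0 <= 1 ^+ 2 + b ^+ 2 :> R by rewrite addr_ge0 ?sqr_ge0.
  rewrite -[leRHS]sqrtr1 ler_sqrt// expr1n => b1.
  suff -> : b = 0 by [].
  by apply/eqP; rewrite -sqrf_eq0 eq_le sqr_ge0 andbT; lra.
- move=> z; have [->|z0] := eqVneq z 0.
    by exists 1; rewrite ?normr1// mul1r normr0.
  (* The conjugate phase of [z]. *)
  exists (`|z| / z); last by rewrite divfK.
  by rewrite normrM normfV normr_id divff ?normr_eq0.
exact: complex_functional.
Qed.

Theorem theorem2p1 (R : realType) :
  (forall (X : completeNormedModType R) (delta : R),
     (exists x : X, x <> 0) -> 0 < delta -> delta < 2 ->
     (BPB_modulus (@idfun R) X delta <= (Num.sqrt (2 * delta))%:E)%E /\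
     (spherical_BPB_modulus (@idfun R) X delta
        <= (Num.sqrt (2 * delta))%:E)%E) /\
  (forall (X : completeNormedModType R[i]) (delta : R),
     (exists x : X, x <> 0) -> 0 < delta -> delta < 2 ->
     (BPB_modulus (@complex.Re R) X delta <= (Num.sqrt (2 * delta))%:E)%E /\
     (spherical_BPB_modulus (@complex.Re R) X delta
        <= (Num.sqrt (2 * delta))%:E)%E).
Proof.
have sphere_ball (K : numFieldType) (re : K -> R) (X : normedModType K)
    (p : X * {linear X -> K^o}) :
    (unit_sphere re (X := X) `*` dual_unit_sphere re (X := X)) p ->
    (unit_ball re (X := X) `*` dual_unit_ball re (X := X)) p.
  move=> [/= p1 [p2 p2n]]; split; first by rewrite /unit_ball /= p1.
  by split=> //=; rewrite p2n.
split=> X delta X0 delta0 delta2; split.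
- exact: (BPB_modulus_on_le (real_scalars_real R)).
- exact: (BPB_modulus_on_le (real_scalars_real R) _ _ _ (sphere_ball _ _ _)).
- exact: (BPB_modulus_on_le (real_scalars_complex R)).
- exact: (BPB_modulus_on_le (real_scalars_complex R) _ _ _ (sphere_ball _ _ _)).
Qed.
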